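(* Let $\Lambda\subseteq\mathbb{R}^n$ be a lattice of full rank, let $v_1,\ldots,v_k\in\mathbb{R}^n$ be such that $v_i-v_j\notin\Lambda$ for all $1\le i<j\le k$, and let $V=\bigcup_{i=1}^k(v_i+\Lambda)$. Let $\ell$ be a positive integer and let $K\subseteq\mathbb{R}^n$ be a closed convex set with $K=-K$ and $\operatorname{vol}(K)\geq 2^n\,\ell\,\frac{\det(\Lambda)}{k}$. Then: (i) $\#\left(K\cap(V-V)\right)\geq 2\ell+1$; and (ii) if $V-V=V\cup(-V)$, then $\#\left(K\cap V\right)\geq\ell+1$.
   Context: A lattice is a discrete subgroup of $\mathbb{R}^n$, always assumed to be of full rank; writing $\Lambda=B\mathbb{Z}^n$ with $B\in\mathbb{R}^{n\times n}$ invertible, its determinant is $\det(\Lambda)=|\det(B)|$. $\operatorname{vol}$ denotes Lebesgue measure, $\#$ denotes cardinality, $V-V=\{x-y : x,y\in V\}$ and $-V=\{-x : x\in V\}$. Here $k\ge1$ and $n\ge 1$ are integers. *)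

(* Defs.v *)
From HB Require Import structures.
From mathcomp Require Import all_boot all_order all_algebra.
From mathcomp Require Import all_classical all_reals all_analysis.
Set Implicit Arguments.
Unset Strict Implicit.
Unset Printing Implicit Defensive.
Import Order.TTheory GRing.Theory Num.Theory.
Import numFieldNormedType.Exports.

Local Open Scope classical_set_scope.
Local Open Scope ring_scope.

Section Lebesgue.
Context {R : realType} {n : nat}.
Local Notation Rn := 'cV[R]_n.

Definition box (ab : Rn * Rn) : set Rn :=
  [set x | forall i, ab.1 i 0 <= x i 0 <= ab.2 i 0].

Definition box_vol (ab : Rn * Rn) : R := \prod_(i < n) (ab.2 i 0 - ab.1 i 0).

(* Degenerate boxes are allowed; for n >= 1 they have volume 0, so a finite
   cover can be padded into a sequence at no cost. *)
Definition box_cover (A : set Rn) : set (nat -> Rn * Rn) :=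
  [set F : nat -> Rn * Rn | (forall j i, (F j).1 i 0 <= (F j).2 i 0)
         /\ A `<=` \bigcup_j box (F j)].

(* n-dimensional Lebesgue measure (n >= 1), as the outer measure generated by
   boxes; compare mu_ext and lebesgue_measure in MathComp-Analysis.  It is
   defined on every set, and is the Lebesgue measure on the measurable ones
   (in particular on closed sets). *)
Definition vol (A : set Rn) : \bar R :=
  ereal_inf [set (\sum_(j <oo) (box_vol (F j))%:E)%E | F in box_cover A].

End Lebesgue.

Section Lattices.
Context {R : realType} {n : nat}.
Local Notation Rn := 'cV[R]_n.

Definition is_subgroup (L : set Rn) : Prop :=
  L 0 /\ forall x y, L x -> L y -> L (x - y).

Definition is_discrete (L : set Rn) : Prop := L `<=` isolated L.

(* The columns of A are n linearly independent vectors of L. *)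
Definition full_rank (L : set Rn) : Prop :=
  exists A : 'M[R]_n, A \in unitmx /\ forall j, L (col j A).

Definition is_lattice (L : set Rn) : Prop :=
  [/\ is_subgroup L, is_discrete L & full_rank L].

Definition int_span (B : 'M[R]_n) : set Rn :=
  [set B *m map_mx intr z | z in [set: 'cV[int]_n]].

Definition lattice_basis (L : set Rn) : set 'M[R]_n :=
  [set B | B \in unitmx /\ L = int_span B].

(* |det B| for any B with L = B Z^n (it does not depend on B); the default 0
   is irrelevant, since every lattice has such a B. *)
Definition lattice_det (L : set Rn) : R :=
  xget 0 [set `|\det B| | B in lattice_basis L].

Definition translate (v : Rn) (L : set Rn) : set Rn := [set v + x | x in L].

Definition neg_set (V : set Rn) : set Rn := [set - x | x in V].

Definition diff_set (V : set Rn) : set Rn := [set x - y | x in V & y in V].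

End Lattices.

(* Main.v *)
(* After the linear change of variables by a basis of the lattice, assume it is Z^n.  The cells of
   the grid (1/N) Z^n that meet a bounded set S are at least N^n vol(S) many; shifting them by
   the v_i and reducing modulo Z^n puts more than l of the resulting points in one class as soon
   as k vol(S) > l (Blichfeldt).  For S = (t/2) K with t > 1 this gives l + 1 points of V whose
   differences are close to K, and for t -> 1, N -> oo they are in K because K is closed and only
   finitely many differences are available.  Subtracting the point of largest norm leaves l nonzero
   differences no two of which are opposite, whence 2 l + 1 points of K and V - V.
   Only upper bounds for the volume are ever needed, so finite box covers suffice. *)
Require Import Defs.
From mathcomp Require Import all_boot all_order all_algebra perm.
From mathcomp Require Import all_classical all_reals all_analysis.
From mathcomp Require Import ring lra zify.
Set Implicit Arguments.
Unset Strict Implicit.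
Unset Printing Implicit Defensive.
Import Order.TTheory GRing.Theory Num.Theory.
Import numFieldNormedType.Exports.

Local Open Scope classical_set_scope.
Local Open Scope ring_scope.

(** * Outer content by finite box covers *)

Section FiniteCovers.
Context {R : realType} {n : nat}.
Local Notation Rn := 'cV[R]_n.
Implicit Types (A B : set Rn) (ab : Rn * Rn) (s : seq (Rn * Rn)).

Definition box_le ab := forall i, ab.1 i 0 <= ab.2 i 0.

Definition box_union s : set Rn := [set x | exists2 ab, ab \in s & box ab x].

(* The Jordan outer content of A is less than c. *)
Definition content_lt A (c : R) := exists s,
  [/\ forall ab, ab \in s -> box_le ab, A `<=` box_union s
    & \sum_(ab <- s) box_vol ab < c].

Lemma box_vol_ge0 ab : box_le ab -> 0 <= box_vol ab.
Proof. by move=> le_ab; apply: prodr_ge0 => i _; rewrite subr_ge0. Qed.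

Lemma content_ltS A B c : A `<=` B -> content_lt B c -> content_lt A c.
Proof. by move=> AB [s [s1 s2 s3]]; exists s; split=> // x /AB /s2. Qed.

Lemma content_ltW A c d : c <= d -> content_lt A c -> content_lt A d.
Proof. by move=> cd [s [s1 s2 s3]]; exists s; split=> //; apply: lt_le_trans cd. Qed.

Lemma content_lt0 c : 0 < c -> content_lt set0 c.
Proof. by move=> c0; exists [::]; rewrite big_nil; split. Qed.

Lemma content_ltU A B c d :
  content_lt A c -> content_lt B d -> content_lt (A `|` B) (c + d).
Proof.
move=> [s [s1 s2 s3]] [t [t1 t2 t3]]; exists (s ++ t); split.
- by move=> ab; rewrite mem_cat => /orP[/s1|/t1].
- by move=> x [/s2|/t2] [ab abs abx]; exists ab => //; rewrite mem_cat abs ?orbT.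
- by rewrite big_cat ltrD.
Qed.

(** A strict bound leaves slack: a cover of total volume less than [c] allows the total error [d]
    times the difference, which is shared among its boxes by repeated halving. *)
Lemma content_lt_map (f : Rn -> Rn) (d : R) A c : 0 < d ->
  (forall ab e, box_le ab -> 0 < e -> content_lt (f @` box ab) (d * box_vol ab + e)) ->
  content_lt A c -> content_lt (f @` A) (d * c).
Proof.
move=> d0 fbox [s [s1 s2 s3]].
have fs e : 0 < e ->
    content_lt (f @` box_union s) (d * \sum_(ab <- s) box_vol ab + e).
  elim: s {s2 s3} s1 e => [|ab s IH] s1 e e0.
    rewrite big_nil mulr0 add0r; apply: content_ltS (content_lt0 e0).
    by move=> y [x []].
  have e2 : 0 < e / 2 by rewrite divr_gt0.
  have sle p : p \in s -> box_le p by move=> ps; apply: s1; rewrite inE ps orbT.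
  have := content_ltU (fbox ab _ (s1 _ (mem_head _ _)) e2) (IH sle _ e2).
  rewrite addrACA -splitr -mulrDr -(big_cons _ _ _ _ xpredT); apply: content_ltS.
  move=> _ [x [p + px] <-]; rewrite inE => /orP[/eqP<-|ps]; first by left; exists x.
  by right; exists x => //; exists p.
have := fs (d * (c - \sum_(ab <- s) box_vol ab)).
rewrite -mulrDr addrCA subrr addr0 mulr_gt0 ?subr_gt0// => /(_ isT).
by apply: content_ltS => _ [x /s2 xs <-]; exists x.
Qed.

End FiniteCovers.

(** * Effect of invertible linear maps on the content *)

Section LinearImages.
Context {R : realType} {n : nat}.
Local Notation Rn := 'cV[R]_n.
Implicit Types (A B : set Rn) (ab : Rn * Rn) (E F T : 'M[R]_n).

(** A one-sided bound; for invertible [E] the opposite one is obtained from the inverse matrix. *)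
Definition scales_content E := forall A c,
  content_lt A c -> content_lt ([set E *m x | x in A]) (`|\det E| * c).

Lemma scales_contentM E F :
  scales_content E -> scales_content F -> scales_content (E *m F).
Proof.
move=> hE hF A c /hF/hE; rewrite det_mulmx normrM mulrA.
by apply: content_ltS => _ [x Ax <-]; exists (F *m x); [exists x | rewrite mulmxA].
Qed.

Lemma scales_content_perm (s : 'S_n) : scales_content (perm_mx s).
Proof.
move=> A c; have d1 : `|\det (perm_mx s)| = 1 :> R by rewrite det_perm normr_sign.
have pE (x : Rn) i : (perm_mx s *m x) i 0 = x (s i) 0 by rewrite -row_permE mxE.
rewrite d1; apply: content_lt_map => // ab e le_ab e0.
exists [:: (perm_mx s *m ab.1, perm_mx s *m ab.2)]; split.
- by move=> _ /[!inE]/eqP-> i; rewrite /= !pE.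
- move=> _ [x xab <-]; exists (perm_mx s *m ab.1, perm_mx s *m ab.2); rewrite ?inE//.
  by move=> i; rewrite /= !pE.
- rewrite big_seq1 mul1r; set v := box_vol _; suff -> : v = box_vol ab by rewrite ltrDl.
  rewrite /v /box_vol [RHS](reindex_inj (@perm_inj _ s)).
  by apply: eq_bigr => i _; rewrite /= !pE.
Qed.

(** The matrix is the identity with [w] added to column [j]. Its row [j] vanishes off the diagonal,
    and the complementary minor is an identity matrix. *)
Lemma det_add_col (w : Rn) j : \det (1%:M + w *m delta_mx 0 j) = 1 + w j 0.
Proof.
set M := 1%:M + _.
have ME i k : M i k = (i == k)%:R + w i 0 * (k == j)%:R.
  by rewrite !mxE big_ord1 !mxE eqxx.
rewrite (expand_det_row M j) (bigD1 j) //= big1 ?addr0 => [|k /negPf kj].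
  rewrite ME !eqxx mulr1 /cofactor addnn -signr_odd odd_double mul1r.
  suff -> : row' j (col' j M) = 1%:M by rewrite det1 mulr1.
  apply/matrixP => i k; rewrite [in LHS]mxE [in LHS]mxE ME mxE.
  by rewrite (inj_eq lift_inj) [_ == j]eq_sym (negPf (neq_lift _ _)) mulr0 addr0.
by rewrite ME eq_sym kj mulr0 addr0 mul0r.
Qed.

Lemma slice_index (a h y : R) m : a <= y <= a + m.+1%:R * h ->
  exists2 p, (p < m.+1)%N & a + p%:R * h <= y <= a + p.+1%:R * h.
Proof.
elim: m => [|m IH] /andP[ay ym]; first by exists 0%N; rewrite // mul0r addr0 ay.
have [ym'|/ltW ym'] := leP y (a + m.+1%:R * h); last by exists m.+1; rewrite // ym' ym.
by have [|p pm hp] := IH; [rewrite ay | exists p => //; rewrite (ltn_trans pm)].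
Qed.

(* The shear is approximated on boxes cut in thin slices orthogonal to the j-th axis. *)
Lemma scales_content_col (w : Rn) j :
  1 + w j 0 != 0 -> scales_content (1%:M + w *m delta_mx 0 j).
Proof.
move=> d0 A c; rewrite det_add_col; set d := 1 + w j 0 in d0 *.
set E := 1%:M + _.
have Ej (x : Rn) : (E *m x) j 0 = d * x j 0.
  rewrite mulmxDl mul1mx -mulmxA mxE [X in _ + X]mxE big_ord1 /d mulrDl mul1r.
  by rewrite -rowE mxE.
have Ei (x : Rn) i : (E *m x) i 0 = x i 0 + w i 0 * x j 0.
  by rewrite mulmxDl mul1mx -mulmxA mxE [X in _ + X]mxE big_ord1 -rowE mxE.
apply: content_lt_map; first by rewrite normr_gt0.
move=> ab e le_ab e0; pose a i := ab.1 i 0; pose b i := ab.2 i 0.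
(* [g.[h]] is the total volume of the covering boxes for slices of thickness [h]. Since [g.[0]] is
   the desired volume, continuity at 0 gives a thickness with error below [e]. *)
pose g : {poly R} := (`|d| * (b j - a j)) *:
  \prod_(i | i != j) ((b i - a i)%:P + `|w i 0| *: 'X).
have gE h : g.[h] = `|d| * (b j - a j) * \prod_(i | i != j) (b i - a i + `|w i 0| * h).
  by rewrite /g hornerZ horner_prod; congr (_ * _); apply: eq_bigr => i _; rewrite !hornerE.
have g0 : g.[0] = `|d| * box_vol ab.
  rewrite gE /box_vol [X in _ = _ * X](bigD1 j)//= mulrA; congr (_ * _).
  by apply: eq_bigr => i _; rewrite mulr0 addr0.
have /cvgr_lt/(_ (`|d| * box_vol ab + e)) := @continuous_horner _ g 0.
rewrite g0 ltrDl e0 => /(_ isT)[r /= r0 gr].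
have [m hm] : exists m, (b j - a j) / m.+1%:R < r.
  have := truncnS_gt ((b j - a j) / r); set m := Num.truncn _ => hm.
  by exists m; rewrite ltr_pdivrMr// mulrC -ltr_pdivrMr.
pose h := (b j - a j) / m.+1%:R.
have h0 : 0 <= h by rewrite divr_ge0// subr_ge0; apply: le_ab.
have mh : m.+1%:R * h = b j - a j by rewrite mulrC divfK.
have {}gr : g.[h] < `|d| * box_vol ab + e by apply: gr; rewrite /= sub0r normrN ger0_norm.
(* On slice [p] the [j]-th coordinate is within [h / 2] of [mid p], so its multiple by [z] varies by
   at most [|z| * (h / 2)], whatever the sign of [z]. *)
pose mid p := a j + p%:R * h + h / 2.
pose lo p i := if i == j then d * mid p - `|d| * (h / 2)
               else a i + w i 0 * mid p - `|w i 0| * (h / 2).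
pose hi p i := if i == j then d * mid p + `|d| * (h / 2)
               else b i + w i 0 * mid p + `|w i 0| * (h / 2).
have lohi p i : lo p i <= hi p i.
  have dh (z : R) : 0 <= `|z| * (h / 2) by rewrite mulr_ge0// divr_ge0.
  have hab := le_ab i; rewrite -/(a i) -/(b i) in hab.
  by rewrite /lo /hi; case: eqP => _; [have := dh d | have := dh (w i 0)]; lra.
pose bx p : Rn * Rn := (\col_i lo p i, \col_i hi p i).
exists [seq bx p | p <- iota 0 m.+1]; split.
- by move=> _ /mapP[p _ ->] i; rewrite /= !mxE.
- move=> _ [x xab <-]; have /(slice_index (m := m))[p pm hp] : a j <= x j 0 <= a j + m.+1%:R * h.
    by rewrite mh addrC subrK; apply: xab.
  have near_mid (z : R) : `|z * x j 0 - z * mid p| <= `|z| * (h / 2).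
    rewrite -mulrBr normrM ler_wpM2l// ler_norml /mid.
    by move: hp; rewrite -[p.+1%:R]natr1 mulrDl mul1r; lra.
  exists (bx p); first by rewrite map_f// mem_iota.
  move=> i; have [-> ->] : (bx p).1 i 0 = lo p i /\ (bx p).2 i 0 = hi p i by rewrite !mxE.
  rewrite /lo /hi; case: eqP => [->|_].
    by rewrite Ej; have := near_mid d; rewrite ler_norml; lra.
  have := near_mid (w i 0); have := xab i; rewrite Ei ler_norml -/(a i) -/(b i); lra.
- rewrite big_map (eq_bigr (fun=> `|d| * h * \prod_(i | i != j) (b i - a i + `|w i 0| * h))).
    rewrite big_const_seq count_predT size_iota iter_addr_0 -mulr_natr.
    by move: gr; rewrite gE -mh; congr (_ < _); ring.
  move=> p _; rewrite /box_vol (bigD1 j)//=; congr (_ * _).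
    by rewrite !mxE /lo /hi eqxx; field.
  by apply: eq_bigr => i /negPf ij; rewrite !mxE /lo /hi ij; field.
Qed.

Definition take_cols T m : 'M[R]_n := \matrix_(i, j) if (j < m)%N then T i j else (i == j)%:R.

(** [take_cols T] leads from the identity to [T] one column at a time. Each passage is a right
    multiplication by a one-column modification of the identity, invertible because both of its
    neighbours are. *)
Lemma scales_content_take_cols T :
  (forall m, take_cols T m \in unitmx) -> scales_content T.
Proof.
move=> uT; suff hm m : scales_content (take_cols T m).
  suff <- : take_cols T n = T by [].
  by apply/matrixP => i j; rewrite mxE ltn_ord.
elim: m => [|m IH].
  have -> : take_cols T 0 = 1%:M by apply/matrixP => i j; rewrite !mxE.
  move=> A c; rewrite det1 normr1 mul1r; apply: content_ltS.
  by move=> _ [x Ax <-]; rewrite mul1mx.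
have [mn|nm] := ltnP m n; last first.
  suff <- : take_cols T m = take_cols T m.+1 by [].
  by apply/matrixP => i j; rewrite !mxE !(leq_trans (ltn_ord j))// leqW.
set j := Ordinal mn; pose M := take_cols T m; pose w := invmx M *m col j T - delta_mx j 0.
have ME : take_cols T m.+1 = M *m (1%:M + w *m delta_mx 0 j).
  rewrite mulmxDr mulmx1 mulmxA mulmxBr mulKVmx ?uT//.
  rewrite -colE; apply/matrixP => i k.
  rewrite mxE [RHS]mxE [X in _ = X + _]mxE [X in _ = _ + X]mxE big_ord1 !mxE eqxx /=.
  rewrite ltnS leq_eqVlt; have [->|kj] := eqVneq k j.
    by rewrite eqxx ltnn mulr1 /=; ring.
  by move: (kj); rewrite -val_eqE => /negPf /= ->; rewrite mulr0 addr0.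
rewrite ME; apply: scales_contentM IH _; apply: scales_content_col.
rewrite -det_add_col; have := uT m.+1; rewrite ME unitmxE det_mulmx unitrM => /andP[_].
by rewrite unitfE.
Qed.

(** Every [take_cols T m] is again triangular, with diagonal entries from [T] or equal to 1, hence
    invertible. *)
Lemma scales_content_lower T : is_trig_mx T -> T \in unitmx -> scales_content T.
Proof.
move=> trT uT; apply: scales_content_take_cols => m.
have trm : is_trig_mx (take_cols T m).
  apply/is_trig_mxP => i j ij; rewrite mxE (is_trig_mxP trT)//.
  by case: ifP => // _; rewrite -val_eqE ltn_eqF.
move: uT; rewrite !unitmxE !unitfE !det_trig// !prodf_seq_neq0 => /allP uT.
by apply/allP => i /uT; rewrite mxE eqxx; case: ifP => // _; rewrite oner_neq0.
Qed.

Lemma scales_content_upper T : is_trig_mx T^T -> T \in unitmx -> scales_content T.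
Proof.
move=> trT uT; apply: scales_content_take_cols => m.
have trm : is_trig_mx (take_cols T m)^T.
  apply/is_trig_mxP => i j ij; rewrite !mxE; have /is_trig_mxP/(_ i j ij) := trT.
  by rewrite mxE => ->; case: ifP => // _; rewrite -val_eqE gtn_eqF.
move: uT; rewrite !unitmxE !unitfE -(det_tr T) -(det_tr (take_cols T m)) !det_trig//.
rewrite !prodf_seq_neq0 => /allP uT.
by apply/allP => i /uT; rewrite !mxE eqxx; case: ifP => // _; rewrite oner_neq0.
Qed.

End LinearImages.

(** By LUP decomposition [E] is a product of a permutation matrix and two invertible triangular
    ones. The empty matrix, treated apart, is itself a permutation matrix. *)
Lemma scales_content_unit (R : realType) n (E : 'M[R]_n) : E \in unitmx -> scales_content E.
Proof.
case: n E => [|n] E uE.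
  by rewrite (flatmx0 E) -(flatmx0 (perm_mx 1)); apply: scales_content_perm.
have := cormen_lup_correct E; have := cormen_lup_perm E; have := cormen_lup_detL E.
have := @cormen_lup_lower _ _ E; have := @cormen_lup_upper _ _ E.
case: (cormen_lup E) => [[P L] U] /= upU lowL detL /is_perm_mxP[s ->] PE.
have uL : L \in unitmx by rewrite unitmxE detL unitr1.
have -> : E = perm_mx s^-1 *m (L *m U).
  by rewrite mulmxE -PE -mulmxE mulmxA -perm_mxM mulVg perm_mx1 mul1mx.
have uU : U \in unitmx.
  have := unitmx_perm R s; move: uE uL; rewrite !unitmxE => uE uL us.
  have := congr1 determinant PE; rewrite -!mulmxE !det_mulmx => detPE.
  by move: (unitrM (\det L) (\det U)); rewrite -detPE unitrM us uE => /esym/andP[].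
apply: scales_contentM; first exact: scales_content_perm.
apply: scales_contentM; first last.
  apply: scales_content_upper => //.
  by apply/is_trig_mxP => i j ij; rewrite mxE upU.
apply: scales_content_lower => //; apply/is_trig_mxP => i j ij.
have le_ij : (i <= j)%N by apply: ltnW.
have /negPf ne_ij : i != j by rewrite -val_eqE ltn_eqF.
by rewrite (lowL _ _ le_ij) ne_ij.
Qed.

(** * Comparison of the outer measure with finite covers *)

Section Volume.
Context {R : realType} {n : nat}.
Local Notation Rn := 'cV[R]_n.
Implicit Types (A : set Rn) (s : seq (Rn * Rn)).
Hypothesis n0 : (0 < n)%N.

Let box_vol00 : box_vol (0 : Rn, 0 : Rn) = 0.
Proof. by rewrite /box_vol (bigD1 (Ordinal n0))//= !mxE subrr mul0r. Qed.

Let box_le_nth s k :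
  (forall ab, ab \in s -> box_le ab) -> box_le (nth (0, 0) s k).
Proof.
move=> s1; have [ks|ks] := ltnP k (size s); first by apply: s1; apply: mem_nth.
by rewrite nth_default// => i; rewrite mxE.
Qed.

Let series_nth s : (forall ab, ab \in s -> box_le ab) ->
  (\sum_(k <oo) (box_vol (nth (0%R, 0%R) s k))%:E = (\sum_(ab <- s) box_vol ab)%:E)%E.
Proof.
move=> s1; rewrite (nneseries_split 0 (size s)) => [|k _]; last first.
  by rewrite lee_fin; apply/box_vol_ge0/box_le_nth.
rewrite eseries0 => [|k /= sk _]; last by rewrite nth_default// box_vol00.
by rewrite addr0 add0n (big_nth (0, 0)) sumEFin.
Qed.

(** A finite cover is padded to a sequence by the degenerate box at the origin, whose volume is 0
    because [n > 0]. *)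
Lemma vol_content_lt A c : content_lt A c -> (vol A < c%:E)%E.
Proof.
move=> [s [s1 s2 s3]]; rewrite /vol.
apply: (@le_lt_trans _ _ (\sum_(ab <- s) box_vol ab)%:E); last by rewrite lte_fin.
apply: ereal_inf_lbound; exists (nth (0, 0) s); last exact: series_nth.
split=> [j|x /s2[ab abs abx]]; first exact: box_le_nth.
by exists (index ab s) => //; rewrite nth_index.
Qed.

(** Cover [A m] with total volume below [e / 2 ^ m.+1], and merge the covers into one sequence by a
    bijection between [nat] and [nat * nat]. *)
Lemma vol_bigcup_content_lt (A : nat -> set Rn) e : 0 < e ->
  (forall m d, 0 < d -> content_lt (A m) d) -> (vol (\bigcup_m A m) <= e%:E)%E.
Proof.
move=> e0 hA; have e2 m : 0 < e / (2 ^ m.+1)%:R by rewrite divr_gt0// ltr0n expn_gt0.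
have /choice[s hs] := fun m => hA m _ (e2 m).
pose G (p : nat * nat) := nth (0, 0) (s p.1) p.2.
have Gle p : box_le (G p) by apply: box_le_nth; have [] := hs p.1.
have Gge0 p : (0 <= (box_vol (G p))%:E)%E by rewrite lee_fin; apply: box_vol_ge0.
have /card_esym/ppcard_eqP[f] := card_nat2.
apply: (@le_trans _ _ (\sum_(k <oo) (box_vol (G (f k)))%:E)%E).
  apply: ereal_inf_lbound; exists (G \o f) => //; split=> [j|x [m _ xAm]]; first exact: Gle.
  have [_ /(_ _ xAm)[ab abs abx] _] := hs m.
  by exists (f^-1%FUN (m, index ab (s m))) => //=; rewrite invK ?inE// /G nth_index.
rewrite nneseries_esumT//.
have /(reindex_esum setT setT f (fun p => (box_vol (G p))%:E)) <- : set_bij [set: nat] [set: nat * nat] f by [].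
have -> : [set: nat * nat] = [set: nat] `*`` (fun=> [set: nat]).
  by apply/seteqP; split=> // -[].
have -> : (fun p => (box_vol (G p))%:E) = (fun p => (box_vol (G (p.1, p.2)))%:E).
  by apply/funext => -[].
rewrite -(esum_esum (a := fun m k => (box_vol (G (m, k)))%:E))//.
have Sm m : (\sum_(k <oo) (box_vol (G (m, k)))%:E = (\sum_(ab <- s m) box_vol ab)%:E)%E.
  by have [/series_nth] := hs m.
have Sge0 m : (0 <= (\sum_(ab <- s m) box_vol ab)%:E)%E.
  by rewrite -Sm; apply: nneseries_ge0 => k _ _; apply: Gge0.
rewrite (eq_esum (b := fun m => (\sum_(ab <- s m) box_vol ab)%:E)); last first.
  by move=> m _; rewrite -Sm nneseries_esumT.
rewrite -nneseries_esumT => [|m]; last first.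
  exact: Sge0.
have := @epsilon_trick R (fun=> 0%E) e xpredT (fun=> lexx _) (ltW e0).
rewrite [X in (_ <= X + _)%E]eseries0// add0e; apply: le_trans.
apply: lee_nneseries => [m _|m _]; last by rewrite add0e lee_fin; have [_ _ /ltW] := hs m.
by move=> _; apply: Sge0.
Qed.

End Volume.

(** * Coordinatewise estimates and simultaneous approximation *)

Section Coordinates.
Context {R : realType} {n : nat}.
Local Notation Rn := 'cV[R]_n.

Lemma nbhs_cVP (x : Rn) (U : set Rn) : nbhs x U ->
  exists2 r : R, 0 < r & forall y : Rn, (forall i, `|x i 0 - y i 0| < r) -> U y.
Proof.
move=> /nbhs_ballP[r r0 rU]; exists r => // y xy; apply: rU.
by split=> // i j; rewrite ord1; apply: xy.
Qed.

Lemma mulmx_coord_bound (A : 'M[R]_n) : exists2 C : R, 0 < C &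
  forall (x : Rn) d, (forall i, `|x i 0| <= d) -> forall i, `|(A *m x) i 0| <= C * d.
Proof.
exists (1 + \sum_i \sum_j `|A i j|).
  by rewrite ltr_pwDl// sumr_ge0// => i _; apply: sumr_ge0.
move=> x d xd i; have d0 : 0 <= d by apply: le_trans (xd i).
rewrite mxE; apply: (le_trans (ler_norm_sum _ _ _)).
apply: (@le_trans _ _ (\sum_j `|A i j| * d)).
  by apply: ler_sum => j _; rewrite normrM ler_wpM2l.
rewrite -mulr_suml ler_wpM2r// [X in 1 + X](bigD1 i)//=.
rewrite -[leLHS]add0r lerD// lerDl.
by apply: sumr_ge0 => k _; apply: sumr_ge0.
Qed.

Definition floor_cV (x : Rn) : 'cV[int]_n := \col_i Num.floor (x i 0).
Definition frac_cV (x : Rn) : Rn := x - map_mx intr (floor_cV x).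

Lemma frac_cV_itv x i : 0 <= frac_cV x i 0 < 1.
Proof.
by rewrite !mxE; have := floor_itv (x i 0); rewrite intrD; lra.
Qed.

(* q cells per coordinate: two of the q^n + 1 multiples 0, y, ..., q^n y share a cell modulo Z^n. *)
Lemma dirichlet_simultaneous (q : nat) (y : Rn) : (0 < q)%N ->
  exists d, [/\ (0 < d <= q ^ n)%N &
    exists z : 'cV[int]_n, forall i, `|(d%:R *: y - map_mx intr z) i 0| < q%:R^-1].
Proof.
move=> q0; pose fr (p : nat) := frac_cV (p%:R *: y).
have q0R : 0 < q%:R :> R by rewrite ltr0n.
have ltq p i : (Num.truncn (q%:R * fr p i 0)%R < q)%N.
  have /andP[f0 f1] := frac_cV_itv (p%:R *: y) i.
  by rewrite truncn_lt_nat ?mulr_ge0// gtr_pMr.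
pose cell (p : 'I_(q ^ n).+1) := [ffun i : 'I_n => Ordinal (ltq p i)].
have : ~~ injectiveb cell.
  apply/negP => /injectiveP/leq_card.
  by rewrite card_ord card_ffun !card_ord ltnn.
move=> /injectivePn[p [p' + E]].
wlog pp : p p' E / (p < p')%N => [H ne|_].
  case: (ltngtP p p') => [pp|pp|/val_inj pp]; [exact: (H p p')| |by rewrite pp eqxx in ne].
  by apply: (H p' p) => //; rewrite eq_sym.
exists (p' - p)%N; split.
  by rewrite subn_gt0 pp /=; have := ltn_ord p'; rewrite ltnS; apply: leq_trans; rewrite leq_subr.
exists (floor_cV (p'%:R *: y) - floor_cV (p%:R *: y)) => i.
have -> : ((p' - p)%:R *: y - map_mx intr (floor_cV (p'%:R *: y) - floor_cV (p%:R *: y))) i 0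
    = fr p' i 0 - fr p i 0.
  by rewrite !mxE natrB 1?ltnW// intrB; ring.
(* Fractional parts in the same cell have equal truncations after multiplication by [q], so they
   differ by less than [1 / q]. *)
have /(congr1 (fun f : {ffun _} => nat_of_ord (f i))) := E; rewrite !ffunE /= => {}E.
have /andP[f0 f1] := frac_cV_itv (p%:R *: y) i.
have /andP[f0' f1'] := frac_cV_itv (p'%:R *: y) i.
rewrite -(ltr_pM2l q0R) mulfV ?gt_eqF// -{1}(gtr0_norm q0R) -normrM ltr_norml.
have := truncn_itv (mulr_ge0 (ltW q0R) f0); have := truncn_itv (mulr_ge0 (ltW q0R) f0').
by rewrite -/(fr p') -/(fr p) -E -[(Num.truncn _).+1%:R]natr1; lra.
Qed.

End Coordinates.

(** * Existence of a lattice basis *)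

Section LatticeBasis.
Context {R : realType} {n : nat}.
Local Notation Rn := 'cV[R]_n.
Variables (L : set Rn).
Hypothesis lat : is_lattice L.

Lemma latticeB x y : L x -> L y -> L (x - y).
Proof. by have [[_ + _] _] := lat; apply. Qed.

Lemma lattice0 : L 0. Proof. by have [[]] := lat. Qed.

Lemma latticeN x : L x -> L (- x).
Proof. by rewrite -sub0r; apply: latticeB; apply: lattice0. Qed.

Lemma latticeD x y : L x -> L y -> L (x + y).
Proof. by move=> Lx /latticeN; rewrite -[y in L (_ + y)]opprK; apply: latticeB. Qed.

Lemma latticeMz x (z : int) : L x -> L (z%:~R *: x).
Proof.
move=> Lx; have Ln p : L (p%:R *: x).
  elim: p => [|p IH]; first by rewrite scale0r; apply: lattice0.
  by rewrite -natr1 scalerDl scale1r; apply: latticeD.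
by case: z => p; [apply: Ln | rewrite NegzE intrN scaleNr; apply/latticeN/Ln].
Qed.

Lemma lattice_int_comb (B : 'M[R]_n) (z : 'cV[int]_n) :
  (forall j, L (col j B)) -> L (B *m map_mx intr z).
Proof.
move=> LB; have -> : B *m map_mx intr z = \sum_j (z j 0)%:~R *: col j B.
  apply/colP => i; rewrite mxE summxE; apply: eq_bigr => j _.
  by rewrite !mxE mulrC.
elim/big_ind: _ => [|x y|j _]; [exact: lattice0|exact: latticeD|exact: latticeMz].
Qed.

(** Approximation gives [d <= q ^ n] with [d y] so close to an integer vector [z] that the lattice
    point [A (d y - z)] lies in a neighbourhood of 0 free of other lattice points. So [d y = z], and
    [d] divides the factorial of [q ^ n]. *)
Lemma lattice_denominator (A : 'M[R]_n) : A \in unitmx -> (forall j, L (col j A)) ->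
  exists2 N, (0 < N)%N & forall y, L (A *m y) -> exists z : 'cV[int]_n, N%:R *: y = map_mx intr z.
Proof.
move=> uA LA; have [[_ _] iso _] := lat.
have [_ [U /nbhs_cVP[r r0 rU] UL]] := iso 0 lattice0.
have [C C0 CA] := mulmx_coord_bound A.
pose q := (Num.truncn (C / r)).+1.
have q0R : 0 < q%:R :> R by rewrite ltr0n.
have Cq : C / q%:R < r by rewrite ltr_pdivrMr// mulrC -ltr_pdivrMr// truncnS_gt.
exists (q ^ n)`!; first exact: fact_gt0.
move=> y Ly; have [//|d [dq [z dz]]] := @dirichlet_simultaneous R n q y.
have Lu : L (A *m (d%:R *: y - map_mx intr z)).
  rewrite mulmxBr -scalemxAr; apply: latticeB; last exact: lattice_int_comb.
  by rewrite -[d%:R]/((d : int)%:~R); apply: latticeMz.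
have : (U `&` L) (A *m (d%:R *: y - map_mx intr z)).
  split=> //; apply: rU => i; rewrite mxE sub0r normrN; apply: le_lt_trans Cq.
  by apply: CA => {}i; apply: ltW.
rewrite UL => /(canRL (mulKmx uA)); rewrite mulmx0 => /eqP; rewrite subr_eq0 => /eqP E.
have /dvdnP[m ->] := dvdn_fact dq; exists (m%:R *: z).
rewrite natrM -scalerA E; apply/colP => i; rewrite !mxE intrM; congr (_ * _).
by rewrite -mulrz_nat.
Qed.

(** The determinants of matrices of lattice vectors take discrete values, so an invertible one of
    least absolute determinant exists. By minimality, coordinates of lattice vectors with respect to
    it have no fractional part. *)
Lemma lattice_basis_nonempty : exists B, lattice_basis L B.
Proof.
have [_ _ [A [uA LA]]] := lat.
have [N N0 hN] := lattice_denominator uA LA.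
have N0R : 0 < N%:R :> R by rewrite ltr0n.
have dA0 : 0 < `|\det A| by rewrite normr_gt0 -unitfE -unitmxE.
(* The quotient is [|\det (N Y)|] with [B = A Y], and [N Y] is an integer matrix. *)
have nat_det B : (forall j, L (col j B)) -> exists m, `|\det B| * N%:R ^+ n / `|\det A| = m%:R :> R.
  move=> LB; pose Y := invmx A *m B; have BE : B = A *m Y by rewrite mulKVmx.
  have /choice[z hz] : forall j, exists z : 'cV[int]_n, N%:R *: col j Y = map_mx intr z.
    by move=> j; apply: hN; rewrite colE mulmxA -BE -colE; apply: LB.
  pose Z := \matrix_(i, j) z j i 0.
  have ZE : N%:R *: Y = map_mx intr Z.
    by apply/matrixP => i j; have /colP/(_ i) := hz j; rewrite !mxE.
  exists `|\det Z|%N; rewrite natr_absz intr_norm -det_map_mx -ZE detZ BE det_mulmx !normrM.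
  by rewrite normrX (gtr0_norm N0R); field; rewrite gt_eqF.
pose P m := `[< exists B, [/\ B \in unitmx, forall j, L (col j B)
   & `|\det B| * N%:R ^+ n / `|\det A| = m%:R :> R] >].
have exP : exists m, P m by have [m hm] := nat_det A LA; exists m; apply/asboolP; exists A.
case: (ex_minnP exP) => m /asboolP[B [uB LB Bm]] min_m; exists B; split=> //.
apply/seteqP; split=> [x Lx|_ [z _ <-]]; last exact: lattice_int_comb.
pose y := invmx B *m x; have xE : x = B *m y by rewrite mulKVmx.
have Lf : L (B *m frac_cV y).
  by rewrite mulmxBr -xE; apply: latticeB => //; apply: lattice_int_comb.
have [f0|] := eqVneq (frac_cV y) 0.
  by exists (floor_cV y) => //; move/eqP: f0; rewrite subr_eq0 => /eqP <-.
move=> /eqP f0; exfalso; have [j fj0] : exists j, frac_cV y j 0 != 0.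
  apply: contrapT => nf; apply: f0; apply/colP => j; rewrite [RHS]mxE.
  by apply/eqP/negPn/negP => fj; apply: nf; exists j.
have /andP[fj_ge0 fj_lt1] := frac_cV_itv y j.
move: (frac_cV y) Lf fj0 fj_ge0 fj_lt1 => f Lf fj0 fj_ge0 fj_lt1 {f0}.
(* Replacing the j-th column of B by the lattice vector B f shrinks the determinant. *)
pose B' := B *m (1%:M + (f - delta_mx j 0) *m delta_mx 0 j).
have dB' : \det B' = \det B * f j 0.
  by rewrite det_mulmx det_add_col !mxE !eqxx addrCA subrr addr0.
have LB' k : L (col k B').
  have -> : col k B' = col k B + (k == j)%:R *: (B *m f - col j B).
    rewrite /B' mulmxDr mulmx1 mulmxA mulmxBr -colE.
    apply/colP => i; rewrite mxE [LHS]mxE [X in _ + X = _]mxE big_ord1 [RHS]mxE [in RHS]mxE.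
    by rewrite [X in _ * X]mxE eqxx /= [X in _ = _ + X]mxE mulrC.
  case: (k == j); last by rewrite scale0r addr0; apply: LB.
  by rewrite scale1r; apply: latticeD => //; apply: latticeB.
have [m' hm'] := nat_det _ LB'.
have := min_m m'; rewrite leqNgt => /(_ _)/negP; apply.
  apply/asboolP; exists B'; split=> //; move: uB; rewrite !unitmxE !unitfE dB' => uB.
  by rewrite mulf_neq0.
rewrite -(ltr_nat R) -hm' -Bm dB' normrM (ger0_norm fj_ge0) -!mulrA ltr_pM2l; last first.
  by rewrite normr_gt0 -unitfE -unitmxE.
by rewrite gtr_pMl// mulr_gt0 ?invr_gt0// exprn_gt0.
Qed.

Lemma lattice_detP : exists2 B, lattice_basis L B & lattice_det L = `|\det B|.
Proof.
have [B LB] := lattice_basis_nonempty; rewrite /lattice_det.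
have [B' LB' <-] := @xgetPex _ 0 [set `|\det B| | B in lattice_basis L] (ex_intro _ _ (ex_intro2 _ _ B LB erefl)).
by exists B'.
Qed.

End LatticeBasis.

(** * Blichfeldt's principle on a grid *)

Lemma pigeonhole_fiber (T T' : finType) (g : T -> T') (D : {set T}) l :
  (l * #|T'| < #|D|)%N ->
  exists p, exists2 a : 'I_l.+1 -> T, injective a & forall i, a i \in D /\ g (a i) = p.
Proof.
move=> lD; have [p hp] : exists p, (l < #|[set d in D | g d == p]%SET|)%N.
  apply: contrapT => nfib; move: lD; rewrite ltnNge => /negP; apply.
  rewrite -sum1_card (partition_big g xpredT)//=.
  rewrite mulnC -sum_nat_const; apply: leq_sum => p _; rewrite leqNgt; apply/negP => hp.
  by apply: nfib; exists p; rewrite -sum1dep_card.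
exists p; exists (fun i => enum_val (widen_ord hp i)).
  by move=> i j /enum_val_inj/(congr1 val)/= /val_inj.
by move=> i; have := enum_valP (widen_ord hp i); rewrite inE => /andP[-> /eqP].
Qed.

Section Blichfeldt.
Context {R : realType} {n : nat}.
Local Notation Rn := 'cV[R]_n.
Variables (S : set Rn) (M N : nat).
Hypothesis N0 : (0 < N)%N.
Hypothesis S_bounded : forall x, S x -> forall i, `|x i 0| <= M%:R.

Let N0R : 0 < N%:R :> R. Proof. by rewrite ltr0n. Qed.

(** Grid cells form a finite type once their corners are shifted by [N * M]. The corner [N * M]
    itself occurs, for points with a coordinate equal to [M]. *)
Let cell := {ffun 'I_n -> 'I_(2 * (N * M)).+1}.
Let corner (f : cell) i : int := (f i : nat)%:Z - (N * M)%N%:Z.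
Let meets (f : cell) := exists2 x, S x & forall i, Num.floor (N%:R * x i 0) = corner f i.
Let X : {set cell} := [set f | `[< meets f >]]%SET.

Let floor_cell x : S x -> exists2 f, f \in X & forall i, Num.floor (N%:R * x i 0) = corner f i.
Proof.
move=> Sx; have floor_bound i : - (N * M)%N%:Z <= Num.floor (N%:R * x i 0) <= (N * M)%N%:Z.
  have := S_bounded Sx i; rewrite ler_norml => /andP[xl xu]; apply/andP; split.
    by rewrite floor_ge_int intrN -pmulrn natrM -mulrN ler_pM2l.
  rewrite -(ler_int R); apply: le_trans (floor_le _) _.
  by rewrite -pmulrn natrM ler_pM2l.
have lt_floor i : (`|(Num.floor (N%:R * x i 0) + (N * M)%N%:Z)%R| < (2 * (N * M)).+1)%N.
  by have := floor_bound i; set z := Num.floor _; lia.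
pose f : cell := [ffun i => Ordinal (lt_floor i)].
suff fx i : Num.floor (N%:R * x i 0) = corner f i.
  by exists f => //; rewrite inE; apply/asboolP; exists x.
rewrite /corner ffunE /=.
by have := floor_bound i; set z := Num.floor _; lia.
Qed.

(** The cells meeting [S] cover it, and each has volume [N ^- n]. *)
Let card_cells c : ~ content_lt S c -> c * N%:R ^+ n <= #|X|%:R.
Proof.
move=> Sc; rewrite leNgt; apply/negP => ltc; apply: Sc.
pose bx (f : cell) : Rn * Rn :=
  (\col_i ((corner f i)%:~R / N%:R), \col_i (((corner f i)%:~R + 1) / N%:R)).
exists [seq bx f | f <- enum X]; split.
- by move=> _ /mapP[f _ ->] i; rewrite !mxE ler_pM2r ?invr_gt0// lerDl.
- move=> x /floor_cell[f fX fx]; exists (bx f); first by rewrite map_f// mem_enum.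
  move=> i; rewrite !mxE -fx ler_pdivrMr// ler_pdivlMr// [x i 0 * _]mulrC.
  by have := floor_itv (N%:R * x i 0); rewrite intrD; lra.
- rewrite big_map big_enum (eq_bigr (fun=> N%:R ^- n)).
    by rewrite sumr_const -[_ *+ #|X|]mulr_natl ltr_pdivrMr// exprn_gt0.
  move=> f _; rewrite -exprVn /box_vol (eq_bigr (fun=> N%:R^-1)).
    by rewrite prodr_const card_ord.
  by move=> i _; rewrite !mxE; field; rewrite gt_eqF.
Qed.

(** There are more than [l * N ^ n] pairs of an index and a cell meeting [S], but only [N ^ n]
    residue classes modulo [N] for the rounded differences between [v i] and the cell. *)
Lemma blichfeldt_grid (k l : nat) (v : 'I_k -> Rn) (c : R) :
  (forall i j z, v i - v j = map_mx intr z -> i = j) ->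
  l%:R < k%:R * c -> ~ content_lt S c ->
  exists u : 'I_l.+1 -> Rn, [/\ injective u,
    forall a, exists i z, u a = v i + map_mx intr z &
    forall a b, exists x y, [/\ S x, S y &
      forall i, `|(u a - u b - (x - y)) i 0| <= 2 / N%:R]].
Proof.
move=> v_inj lkc /card_cells cX.
pose d (p : 'I_k * cell) j : int := Num.floor (N%:R * v p.1 j 0) - (p.2 j : nat)%:Z.
have ltN p j : (`|(d p j %% N)%Z| < N)%N.
  have N0z : N%:Z != 0 by rewrite eqz_nat -lt0n.
  by rewrite -ltz_nat gez0_abs ?modz_ge0// ltz_pmod.
pose g p := [ffun j : 'I_n => Ordinal (ltN p j)].
have [|r [e e_inj he]] := @pigeonhole_fiber _ _ g (finset.setX [set: 'I_k]%SET X) l.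
  rewrite card_ffun !card_ord cardsX cardsT card_ord -(ltr_nat R) !natrM natrX.
  rewrite -(ltr_pM2r (exprn_gt0 n N0R)) in lkc; apply: lt_le_trans lkc _.
  by rewrite -mulrA ler_wpM2l.
have dE a j : d (e a) j = (d (e a) j %/ N)%Z * N%:Z + (r j : nat)%:Z.
  have [_ <-] := he a; rewrite ffunE /= gez0_abs -?divz_eq//.
  by rewrite modz_ge0// eqz_nat -lt0n.
pose w a : 'cV[int]_n := \col_j (d (e a) j %/ N)%Z.
have /choice[s hs] : forall a, exists x, S x /\
    forall j, Num.floor (N%:R * x j 0) = corner (e a).2 j.
  move=> a; have [+ _] := he a; rewrite !inE /= => -[x Sx hx].
  by exists x.
exists (fun a => v (e a).1 - map_mx intr (w a)); split.
(* Equal points have equal indices, as the [v i] are incongruent; then their integer parts agree,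
   and so do the cells, since the residue [r] is common. *)
- move=> a b E; apply: e_inj.
  have iE : (e a).1 = (e b).1.
    apply: (v_inj _ _ (w a - w b)); rewrite map_mxB.
    by apply/eqP; rewrite subr_eq (canRL (subrK _) E) addrC addrA addrAC.
  have wE : w a = w b.
    move: E; rewrite iE => /addrI/oppr_inj/matrixP E.
    by apply/colP => j; have := E j 0; rewrite !mxE => /intr_inj.
  apply/eqP; rewrite -pair_eqE /= iE eqxx /=; apply/eqP/ffunP => j; apply: val_inj => /=.
  have /colP/(_ j) := wE; rewrite !mxE; have := dE a j; have := dE b j.
  move=> hb ha E1; have : d (e a) j = d (e b) j by rewrite ha E1 -hb.
  by rewrite /d iE => /addrI/oppr_inj [->].
- by move=> a; exists (e a).1, (- w a); rewrite map_mxN.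
- move=> a b; exists (s a), (s b); split; [by case: (hs a)|by case: (hs b)|move=> j].
  (* The main term does not depend on [t] and cancels in differences; [q] is a difference of two
     fractional parts. *)
  have near t : exists2 q : R, `|q| <= 1 & N%:R * (v (e t).1 j 0 - (w t j 0)%:~R - s t j 0)
      = (r j + N * M)%N%:R + q.
    have [_ /(_ j) hst] := hs t.
    exists ((N%:R * v (e t).1 j 0 - (Num.floor (N%:R * v (e t).1 j 0))%:~R)
         - (N%:R * s t j 0 - (Num.floor (N%:R * s t j 0))%:~R)).
      have := floor_itv (N%:R * v (e t).1 j 0); have := floor_itv (N%:R * s t j 0).
      by rewrite !intrD ler_norml; lra.
    have := congr1 (fun z : int => z%:~R : R) (dE t j).
    rewrite hst /corner mxE /d; move: (_ %/ _)%Z => q.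
    by rewrite !intrB intrD intrM natrD /=; lra.
  have [qa qa1 ha] := near a; have [qb qb1 hb] := near b.
  rewrite ler_pdivlMr// -[X in _ * X](gtr0_norm N0R) -normrM.
  suff -> : ((v (e a).1 - map_mx intr (w a) - (v (e b).1 - map_mx intr (w b)) - (s a - s b)) j 0) * N%:R = qa - qb.
    by apply: le_trans (ler_normB _ _) _; lra.
  rewrite !mxE; move: ha hb; rewrite !mxE; lra.
Qed.

End Blichfeldt.

(** * From approximate to exact membership of differences *)

Section SymmetricConvex.
Context {R : realType} {n : nat}.
Local Notation Rn := 'cV[R]_n.
Implicit Types (K S : set Rn).

Lemma convex_setP K : convex_set K ->
  forall x y (t : R), K x -> K y -> 0 <= t <= 1 -> K (t *: x + (1 - t) *: y).
Proof.
move=> Kc x y t Kx Ky t01.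
have [t0 t1] := andP t01.
pose s : {i01 R} := Itv01 t0 t1.
by have := Kc x y s; rewrite !inE => /(_ Kx Ky).
Qed.

(** A point outside [K] has a neighbourhood disjoint from [K]. The threshold for [N] depends on [w],
    so it is applied to finitely many points only. *)
Lemma closed_approx K (w : Rn) (C : R) : closed K ->
  \forall N \near \oo, forall y, K y -> (forall i, `|(w - y) i 0| <= C / N.+1%:R) -> K w.
Proof.
move=> Kcl; have [Kw|nKw] := pselect (K w); first by near=> N.
have /nbhs_cVP[r r0 rK] : nbhs w (~` K) by apply: open_nbhs_nbhs; split=> //; apply: closed_openC.
near=> N => y Ky wy; exfalso; apply: (rK y) => // i.
have := wy i; rewrite !mxE => /le_lt_trans; apply.
rewrite ltr_pdivrMr// mulrC -ltr_pdivrMr// (lt_trans (_ : _ < N%:R)) ?ltr_nat//.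
by near: N; apply: nbhs_infty_gtr.
Unshelve. all: by end_near. Qed.

Lemma content_lt_scale S (t c : R) : 0 < t ->
  content_lt [set t *: x | x in S] (t ^+ n * c) -> content_lt S c.
Proof.
move=> t0 St; have uE : (t^-1)%:M \in @unitmx R n.
  by rewrite unitmxE det_scalar unitfE expf_neq0// invr_neq0// gt_eqF.
have := scales_content_unit uE St.
rewrite det_scalar normrX normfV (gtr0_norm t0) mulrA -exprMn mulVf ?gt_eqF// expr1n mul1r.
apply: content_ltS => x Sx; exists (t *: x); first by exists x.
by rewrite mul_scalar_mx scalerA mulVf ?gt_eqF// scale1r.
Qed.

Lemma blichfeldt_convex (k l M : nat) (v : 'I_k -> Rn) K S :
  (0 < n)%N -> (0 < k)%N -> (0 < l)%N ->
  (forall i j z, v i - v j = map_mx intr z -> i = j) ->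
  closed K -> (forall x y, K x -> K y -> K (2^-1 *: (x - y))) ->
  S `<=` K -> (forall x, S x -> forall i, `|x i 0| <= M%:R) ->
  ~ content_lt S (2 ^+ n * l%:R / k%:R) ->
  exists u : 'I_l.+1 -> Rn, [/\ injective u,
    forall a, exists i z, u a = v i + map_mx intr z & forall a b, K (u a - u b)].
Proof.
move=> n0 k0 l0 v_inj Kcl Kmid SK SM Svol.
have k0R : 0 < k%:R :> R by rewrite ltr0n.
have l0R : 0 < l%:R :> R by rewrite ltr0n.
pose C := \sum_i \sum_m `|v i m 0|.
have vC i m : `|v i m 0| <= C.
  rewrite /C (bigD1 i)//= (bigD1 m)//= -addrA lerDl addr_ge0//; apply: sumr_ge0 => // j _.
  exact: sumr_ge0.
(* Differences of the points found below have coordinates at most [2 M + 2], and those of the [v i]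
   at most [2 C], so [Q] bounds the integer parts and [cand] lists every possible difference. *)
pose Q := (Num.truncn (2 * M%:R + 2 + 2 * C)).+1.
pose cand (p : 'I_k * 'I_k * {ffun 'I_n -> 'I_(2 * Q).+1}) : Rn :=
  v p.1.1 - v p.1.2 + map_mx intr (\col_i ((p.2 i : nat)%:Z - Q%:Z)).
have /filter_ex[N hN] : \forall N \near \oo, forall p, forall y, K y ->
    (forall i, `|(cand p - y) i 0| <= (2 + M%:R) / N.+1%:R) -> K (cand p).
  by apply: filter_forall => p; apply: closed_approx.
have [e [e0 e1 eE]] : exists e : R, [/\ 0 < e, e <= 1 & e = N.+1%:R^-1].
  by exists N.+1%:R^-1; split=> //; rewrite invf_le1// ler1n.
(* With [t > 1], the non-strict volume bound becomes the strict one [l < t ^+ n * l]. *)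
rewrite -eE in hN; pose t := 1 + e.
pose T := [set (t / 2) *: x | x in S].
have TM x : T x -> forall i, `|x i 0| <= M%:R.
  move=> [y Sy <-] i; rewrite mxE normrM.
  have := SM _ Sy i; rewrite [`|t / 2|]ger0_norm; last by rewrite /t; lra.
  apply: le_trans; rewrite ler_piMl// /t; lra.
have Tvol : ~ content_lt T (t ^+ n * l%:R / k%:R).
  have -> : t ^+ n * l%:R / k%:R = (t / 2) ^+ n * (2 ^+ n * l%:R / k%:R).
    by rewrite !mulrA -exprMn divfK// pnatr_eq0.
  by move=> /content_lt_scale; apply: contra_not Svol; apply; rewrite /t; lra.
have [|u [u_inj uv uT]] := blichfeldt_grid (ltn0Sn N) TM (l := l) v_inj _ Tvol.
  rewrite [ltRHS]mulrC divfK ?gt_eqF// ltr_pMl//.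
  by rewrite exprn_egt1// /t ?ltrDl// -lt0n.
exists u; split=> // a b.
have [x' [y' [[x Sx <-] [y Sy <-] uxy]]] := uT a b.
have Ky : K (2^-1 *: (x - y)) by apply: Kmid; apply: SK.
(* The grid contributes [2 e], and replacing [t / 2] by [1 / 2] at most [M e]. *)
have uK i : `|(u a - u b - 2^-1 *: (x - y)) i 0| <= (2 + M%:R) * e.
  have := uxy i; have := SM _ Sx i; have := SM _ Sy i; rewrite !mxE !ler_norml.
  rewrite -eE /t => h1 h2 h3.
  have hx : - (M%:R * e) <= x i 0 * e <= M%:R * e.
    by rewrite -mulNr !ler_pM2r.
  have hy : - (M%:R * e) <= y i 0 * e <= M%:R * e.
    by rewrite -mulNr !ler_pM2r.
  lra.
have [i [z1 E1]] := uv a; have [j [z2 E2]] := uv b.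
have zQ m : - Q%:Z <= (z1 - z2) m 0 <= Q%:Z.
  suff : `|((z1 - z2) m 0)%:~R| <= Q%:R :> R.
    by rewrite -intr_norm -[Q%:R]/(Q%:Z%:~R) ler_int ler_norml.
  have -> : ((z1 - z2) m 0)%:~R = (u a - u b) m 0 - (v i m 0 - v j m 0) :> R.
    by rewrite E1 E2 !mxE intrB; ring.
  have hQ := ltW (truncnS_gt (2 * M%:R + 2 + 2 * C)).
  apply: le_trans hQ; have := uK m; have := vC i m; have := vC j m.
  have := SM _ Sx m; have := SM _ Sy m.
  have : (2 + M%:R) * e <= 2 + M%:R :> R by rewrite ler_piMr// addr_ge0.
  rewrite !mxE !ler_norml; lra.
have ltQ m : (`|((z1 - z2) m 0 + Q%:Z)%R| < (2 * Q).+1)%N by have := zQ m; lia.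
have candE : cand (i, j, [ffun m => Ordinal (ltQ m)]) = u a - u b.
  apply/colP => m; rewrite E1 E2 /cand !mxE ffunE /=.
  rewrite gez0_abs; last by have /andP[+ _] := zQ m; rewrite -subr_ge0 opprK.
  by rewrite addrK !mxE intrB; ring.
by rewrite -candE; apply: (hN _ _ Ky) => m; rewrite candE.
Qed.

End SymmetricConvex.

(** * Reduction to a bounded part of the convex set *)

Section BoundedPart.
Context {R : realType} {n : nat}.
Local Notation Rn := 'cV[R]_n.
Variable K : set Rn.
Hypothesis Kconv : forall x y (t : R), K x -> K y -> 0 <= t <= 1 -> K (t *: x + (1 - t) *: y).
Hypothesis KN : forall x, K x -> K (- x).

Let K_ (M : nat) := K `&` [set x | forall i, `|x i 0| <= M%:R].

Let bigcup_K_ : \bigcup_M K_ M = K.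
Proof.
apply/seteqP; split=> [x [M _ []]//|x Kx].
exists (Num.truncn (\sum_i `|x i 0|)).+1 => //; split=> // i.
apply: le_trans (ltW (truncnS_gt _)); rewrite (bigD1 i)//= lerDl.
exact: sumr_ge0.
Qed.

Lemma symmetric_convex_mid x y : K x -> K y -> K (2^-1 *: (x - y)).
Proof.
move=> Kx /KN Ky; have := Kconv (t := 2^-1) Kx Ky.
by rewrite scalerBr scalerN [1 - _](_ : _ = 2^-1)//; [apply; lra|lra].
Qed.

Lemma symmetric_convex_scale x (s : R) : K x -> `|s| <= 1 -> K (s *: x).
Proof.
move=> Kx; rewrite ler_norml => s1.
have := Kconv (t := (1 + s) / 2) Kx (KN Kx); rewrite scalerN -scaleNr -scalerDl.
by rewrite (_ : _ + - _ = s); [apply; lra|lra].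
Qed.

(* If K is unbounded, stretching a truncation of K towards a far point of K stays inside K and
   multiplies the content by an arbitrarily large factor. *)
Lemma bounded_part_content (c : R) : (0 < n)%N -> 0 < c -> (c%:E <= vol K)%E ->
  exists M : nat, exists2 S, S `<=` K /\ (forall x, S x -> forall i, `|x i 0| <= M%:R) &
    ~ content_lt S c.
Proof.
move=> n0 c0 Kc; apply: contrapT => nM.
have KM M : content_lt (K_ M) c.
  by apply: contrapT => hM; apply: nM; exists M, (K_ M) => //; split=> x [].
(* A bounded [K] would be one of its truncations, all of content below [c]. Symmetry makes the large
   coordinate positive. *)
have unb (W : nat) : exists x i, K x /\ W%:R < x i 0.
  apply: contrapT => nW; suff : content_lt K c.
    by move/(vol_content_lt n0); rewrite ltNge Kc.
  apply: content_ltS (KM W) => x Kx; split=> // i; rewrite leNgt; apply/negP => xi; apply: nW.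
  have [x0|x0] := leP 0 (x i 0); first by exists x, i; rewrite ger0_norm in xi.
  by exists (- x), i; rewrite mxE; rewrite ltr0_norm// in xi; split=> //; apply: KN.
(* Otherwise all truncations would be null, and [K] would have volume at most [c / 2]. *)
have [M [d d0 Md]] : exists M, exists2 d, 0 < d & ~ content_lt (K_ M) d.
  apply: contrapT => nd; have c2 : 0 < c / 2 by rewrite divr_gt0.
  have /(vol_bigcup_content_lt n0 c2) : forall M d, 0 < d -> content_lt (K_ M) d.
    by move=> M d d0; apply: contrapT => Md; apply: nd; exists M, d.
  rewrite bigcup_K_ => /(le_trans Kc); rewrite lee_fin; lra.
pose m : R := M.+1%:R; have m0 : 0 < m by rewrite ltr0n.
(* Chosen so that [W / m / 2 ^+ n = c / d], which makes the determinant of the stretching [A] exceed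
   [c / d]. *)
pose W := 2 ^+ n * m * c / d.
have [x [i [Kx xW]]] := unb (Num.truncn W).+1.
have {}xW : W < x i 0 := lt_trans (truncnS_gt W) xW.
have W0 : 0 < W by rewrite !(mulr_gt0, invr_gt0, exprn_gt0).
(* [A y] is the midpoint of [y] and [(y i 0 / m) *: x]; on [K_ M] the factor has absolute value at
   most 1, so both points are in [K]. *)
pose A := 2^-1 *: (1%:M + (m^-1 *: x) *m delta_mx 0 i).
have detA : \det A = 2^-1 ^+ n * (1 + x i 0 / m).
  by rewrite detZ det_add_col mxE [m^-1 * _]mulrC.
have detA_gt : c / d < \det A.
  rewrite detA exprVn [ltRHS]mulrC ltr_pdivlMr ?exprn_gt0//.
  apply: (@lt_trans _ _ (x i 0 / m)); last by rewrite ltrDr.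
  rewrite ltr_pdivlMr//; apply: le_lt_trans xW; rewrite /W le_eqVlt; apply/orP; left.
  by apply/eqP; field; rewrite gt_eqF.
have detA_gt0 : 0 < \det A by apply: lt_trans detA_gt; rewrite divr_gt0.
have uA : A \in unitmx by rewrite unitmxE unitfE gt_eqF.
have AE (y : Rn) : A *m y = 2^-1 *: (y - - ((y i 0 / m) *: x)).
  rewrite -scalemxAl mulmxDl mul1mx opprK -mulmxA -rowE; congr (_ *: (_ + _)).
  by apply/colP => j; rewrite !mxE big_ord1 !mxE; ring.
have AK y : K_ M y -> K (A *m y).
  move=> [Ky yM]; rewrite AE; apply: symmetric_convex_mid => //; apply: KN.
  apply: symmetric_convex_scale => //; rewrite normrM normfV (gtr0_norm m0).
  by rewrite ler_pdivrMr// mul1r (le_trans (yM i))// ler_nat.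
have [C C0 CA] := mulmx_coord_bound A.
have AKM : [set A *m y | y in K_ M] `<=` K_ (Num.truncn (C * M%:R)).+1.
  move=> _ [y yM <-]; split; first exact: AK.
  by move=> j; apply: le_trans (ltW (truncnS_gt _)); apply: CA; have [] := yM.
have := content_ltS AKM (KM _); have uA' : invmx A \in unitmx by rewrite unitmx_inv.
(* The image lies in a truncation of content below [c]; pulled back by the inverse of [A], [K_ M]
   has content below [c / \det A < d]. *)
move=> /(scales_content_unit uA'); rewrite det_inv => Ac; apply: Md.
apply: content_ltW (content_ltS _ Ac) => [|y yM].
  rewrite gtr0_norm ?invr_gt0// mulrC ler_pdivrMr// mulrC -ler_pdivrMr//.
  exact: ltW.
by exists (A *m y); [exists y | rewrite mulKmx].
Qed.

End BoundedPart.

(** * Continuity of linear maps and cardinality bounds from injections *)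

Local Open Scope card_scope.

Lemma mulmx_cV_continuous (R : realType) n (B : 'M[R]_n) : continuous (fun x : 'cV[R]_n => B *m x).
Proof.
move=> x U /nbhs_cVP[r r0 rU]; have [C C0 CB] := mulmx_coord_bound B.
apply/nbhs_ballP; exists (r / (2 * C)) => [|y [_ xy]] /=; first by rewrite divr_gt0// mulr_gt0.
apply: rU => i.
have xyd : forall j, `|(x - y) j 0| <= r / (2 * C) by move=> j; rewrite !mxE; apply/ltW/xy.
have := CB _ _ xyd i; rewrite mulmxBr !mxE => /le_lt_trans; apply.
rewrite (_ : C * _ = r / 2); first by rewrite ltr_pdivrMr// ltr_pMr// ltr1n.
by field; rewrite gt_eqF.
Qed.

Lemma card_le_inj (T : Type) (A : set T) (m : nat) (I : finType) (h : I -> T) :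
  #|I| = m -> injective h -> (forall i, A (h i)) -> `I_m #<= A.
Proof.
move=> <- h_inj hA; have [->|/card_gt0P[i0 _]] := posnP #|I|.
  by rewrite II0 card_ge0.
pose g p := h (nth i0 (enum I) p).
have g_inj : {in `I_#|I| &, injective g}.
  move=> p q; rewrite !inE /= cardE => pI qI /h_inj/eqP.
  by rewrite nth_uniq ?enum_uniq// => /eqP.
apply: card_le_trans (subset_card_le (_ : [set g p | p in `I_#|I|] `<=` A)).
  by rewrite (card_le_eql (card_esym (inj_card_eq g_inj))).
by move=> _ [p _ <-]; apply: hA.
Qed.

(** * Counting differences from an extreme point *)

Section DifferenceSets.
Context {R : realType} {n l : nat}.
Local Notation Rn := 'cV[R]_n.
Variable u : 'I_l.+1 -> Rn.
Hypothesis u_inj : injective u.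

(* A point of maximal Euclidean norm is no midpoint of two other points. *)
Lemma exists_extreme_point : exists a0, forall a b, (u a - u a0) + (u b - u a0) = 0 -> a = a0.
Proof.
pose N a := \sum_i (u a i 0) ^+ 2.
case: (@arg_maxP _ _ _ (ord0 : 'I_l.+1) xpredT N isT) => a0 _ max_a0; exists a0 => a b ab0.
apply: u_inj; apply/colP => i.
have ub j : u b j 0 = 2 * u a0 j 0 - u a j 0.
  by have /colP/(_ j) := ab0; rewrite !mxE; lra.
(* Parallelogram law; by maximality of [N a0] the last sum must vanish. *)
have NE : N a + N b = 2 * N a0 + 2 * \sum_j (u a j 0 - u a0 j 0) ^+ 2.
  rewrite /N !mulr_sumr -!big_split; apply: eq_bigr => j _ /=; rewrite ub; ring.
have := max_a0 a isT; have := max_a0 b isT.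
move=> /= hb ha.
have S0 : \sum_j (u a j 0 - u a0 j 0) ^+ 2 = 0.
  apply/eqP; rewrite eq_le; apply/andP; split; last by apply: sumr_ge0 => j _; apply: sqr_ge0.
  by move: NE hb ha; rewrite -/(N a); lra.
have /eqP : (u a i 0 - u a0 i 0) ^+ 2 = 0.
  by apply: (psumr_eq0P _ S0) => // j _; apply: sqr_ge0.
by rewrite sqrf_eq0 subr_eq0 => /eqP.
Qed.

Variables V K : set Rn.
Hypothesis KN : forall x, K x -> K (- x).
Hypothesis Vu : forall a, V (u a).
Hypothesis Ku : forall a b, K (u a - u b).

Lemma card_differences : `I_(2 * l + 1) #<= K `&` diff_set V.
Proof.
have [a0 extr] := exists_extreme_point; pose d a := u a - u a0.
have d_inj : injective d by move=> a b /addIr/u_inj.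
(* [lift a0] skips [a0], so the difference 0 is counted once, and extremality separates the other
   differences from the opposites. *)
pose h (s : 'I_l.+1 + 'I_l) := match s with inl a => d a | inr b => - d (lift a0 b) end.
apply: (@card_le_inj _ _ _ _ h); first by rewrite card_sum !card_ord; lia.
- move=> [a|a] [b|b] /= E.
  + by rewrite (d_inj _ _ E).
  + have dba : d (lift a0 b) + d a = 0 by rewrite E subrr.
    by have /eqP := extr _ _ dba; rewrite eq_sym (negPf (neq_lift _ _)).
  + have dab : d (lift a0 a) + d b = 0 by rewrite -E subrr.
    by have /eqP := extr _ _ dab; rewrite eq_sym (negPf (neq_lift _ _)).
  + by rewrite (lift_inj (d_inj _ _ (oppr_inj E))).
- move=> [a|b] /=; rewrite /d ?opprB; split=> //; last by exists (u a0) => //; eexists.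
  by exists (u a) => //; exists (u a0).
Qed.

(** Each difference or its opposite lies in [V]. Choosing one of the two loses no points, because no
    two distinct indices give opposite differences. *)
Lemma card_symmetric_differences :
  diff_set V = V `|` neg_set V -> `I_(l + 1) #<= K `&` V.
Proof.
move=> VV; have [a0 extr] := exists_extreme_point; pose d a := u a - u a0.
have d_inj : injective d by move=> a b /addIr/u_inj.
have Vd a : V (d a) \/ V (- d a).
  have : diff_set V (d a) by exists (u a) => //; exists (u a0).
  by rewrite VV => -[|[x Vx <-]]; [left | right; rewrite opprK].
have opp_d a b : d a = - d b -> a = b.
  move=> dab; have E : d a + d b = 0 by rewrite dab addNr.
  by rewrite (extr _ _ E) (extr b a)// addrC.
pose h a := if `[< V (d a) >] then d a else - d a.
apply: (@card_le_inj _ _ _ _ h); first by rewrite card_ord addn1.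
- move=> a b; rewrite /h; case: ifP => _; case: ifP => _.
  + exact: d_inj.
  + exact: opp_d.
  + by move/esym/opp_d.
  + by move/oppr_inj/d_inj.
- move=> a; rewrite /h; case: asboolP => Va; split=> //; first exact: Ku.
  + by apply/KN/Ku.
  + by case: (Vd a).
Qed.

End DifferenceSets.

(** * Transport to the integer lattice and back *)

Theorem theorem2p3 (R : realType) (n k l : nat)
  (hn : (1 <= n)%N) (hk : (1 <= k)%N) (hl : (1 <= l)%N)
  (L : set 'cV[R]_n) (hL : is_lattice L)
  (v : 'I_k -> 'cV[R]_n)
  (hv : forall i j : 'I_k, (i < j)%N -> ~ L (v i - v j))
  (V : set 'cV[R]_n) (hV : V = \bigcup_i translate (v i) L)
  (K : set 'cV[R]_n) (Kclosed : closed K)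
  (Kconvex : convex_set K) (Ksym : K = neg_set K)
  (Kvol : ((2 ^+ n * l%:R * (lattice_det L / k%:R))%:E <= vol K)%E) :
  `I_(2 * l + 1) #<= K `&` diff_set V /\
  (diff_set V = V `|` neg_set V -> `I_(l + 1) #<= K `&` V).
Proof.
have [B [uB LB] detL] := lattice_detP hL; rewrite {}detL in Kvol.
have dB0 : 0 < `|\det B| by rewrite normr_gt0 -unitfE -unitmxE.
have k0R : 0 < k%:R :> R by rewrite ltr0n.
have KN x : K x -> K (- x) by move=> Kx; rewrite Ksym; exists x.
have Kc := convex_setP Kconvex.
have c0 : 0 < 2 ^+ n * l%:R * (`|\det B| / k%:R).
  by rewrite !mulr_gt0 ?invr_gt0// ?exprn_gt0// ltr0n.
have [M0 [S0 [S0K S0M] S0vol]] := bounded_part_content Kc KN hn c0 Kvol.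
(* Multiplication by the inverse of [B] turns [L] into the integer lattice and divides contents by
   [|\det B|], the lattice determinant. *)
pose K' := [set x | K (B *m x)]; pose S := [set invmx B *m x | x in S0].
have SK' : S `<=` K' by move=> _ [x /S0K Kx <-]; rewrite /K' /= mulKVmx.
have [C C0 CB] := mulmx_coord_bound (invmx B).
pose M := (Num.truncn (C * M0%:R)).+1.
have SM x : S x -> forall i, `|x i 0| <= M%:R.
  move=> [y Sy <-] i; apply: le_trans (ltW (truncnS_gt _)); apply: CB.
  exact: S0M.
have Svol : ~ content_lt S (2 ^+ n * l%:R / k%:R).
  move/(scales_content_unit uB) => SB; apply: S0vol.
  have -> : 2 ^+ n * l%:R * (`|\det B| / k%:R) = `|\det B| * (2 ^+ n * l%:R / k%:R) by ring.
  apply: content_ltS SB => x Sx; exists (invmx B *m x); first by exists x.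
  by rewrite mulKVmx.
have v_inj i j z : invmx B *m v i - invmx B *m v j = map_mx intr z -> i = j.
  rewrite -mulmxBr => /(congr1 (mulmx B)); rewrite mulKVmx// => vij.
  have Lij : L (v i - v j) by rewrite LB vij; exists z.
  have Lji : L (v j - v i) by rewrite -opprB; apply: (latticeN hL).
  by case: (ltngtP i j) => [/hv|/hv|/val_inj].
have K'cl : closed K'.
  by apply: (@preimage_closed _ _ (mulmx B)) Kclosed => x _; apply: mulmx_cV_continuous.
have K'mid x y : K' x -> K' y -> K' (2^-1 *: (x - y)).
  by move=> Kx Ky; rewrite /K' /= -scalemxAr mulmxBr; apply: symmetric_convex_mid.
have [u [u_inj uv Ku]] := blichfeldt_convex hn hk hl v_inj K'cl K'mid SK' SM Svol.
have Bu_inj : injective (fun a => B *m u a).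
  by move=> a b /(congr1 (mulmx (invmx B))); rewrite !mulKmx// => /u_inj.
have VBu a : V (B *m u a).
  have [i [z ->]] := uv a; rewrite hV mulmxDr mulKVmx//; exists i => //.
  by exists (B *m map_mx intr z) => //; rewrite LB; exists z.
have KBu a b : K (B *m u a - B *m u b) by rewrite -mulmxBr; apply: Ku.
split; first exact: (card_differences (u := fun a => B *m u a) Bu_inj VBu KBu).
exact: (card_symmetric_differences (u := fun a => B *m u a) Bu_inj KN VBu KBu).
Qed.
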